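(* Let $X$ be a real Banach space and let $Y$ be a closed subspace of $X$ such that every separable (closed) subspace of $Y$ has property-$(wU)$ in $X$. Then $Y$ has property-$(wU)$ in $X$.
   Context: A closed subspace $Y$ of $X$ has property-$(wU)$ in $X$ if every $y^*\in Y^*$ satisfying $\|y^*\|=|y^*(y_0)|$ for some $y_0\in S_Y$ (the unit sphere of $Y$) has a unique norm-preserving extension to $X$. *)

(* Defs.v *)
From HB Require Import structures.
From mathcomp Require Import all_boot all_order all_algebra.
From mathcomp Require Import all_classical all_reals all_analysis.
Import Order.TTheory GRing.Theory Num.Theory.
Import numFieldNormedType.Exports.

Set Implicit Arguments.
Unset Strict Implicit.
Unset Printing Implicit Defensive.

Local Open Scope classical_set_scope.
Local Open Scope ring_scope.

(* A linear subspace Y of X is a bundled predicate [Y : submodClosed X];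
   [subsp Y] is Y regarded as a normed space in its own right, with the norm
   (hence also the topology) inherited from X. *)
Definition subsp (R : realType) (X : normedModType R) (Y : submodClosed X) :=
  {x : X | x \in Y}.

Section subsp_normed.
Context (R : realType) (X : normedModType R) (Y : submodClosed X).

HB.instance Definition _ := SubChoice.on (subsp Y).
HB.instance Definition _ := [SubChoice_isSubLmodule of subsp Y by <:].

Let nrm (y : subsp Y) : R := `|val y|.

Let ler_nrmD (x y : subsp Y) : nrm (x + y) <= nrm x + nrm y.
Proof. by rewrite /nrm raddfD ler_normD. Qed.

Let nrmZ (a : R) (x : subsp Y) : nrm (a *: x) = `|a| * nrm x.
Proof. by rewrite /nrm linearZ normrZ. Qed.

Let nrm0_eq0 (x : subsp Y) : nrm x = 0 -> x = 0.
Proof. by move=> /normr0_eq0 x0; apply/val_inj; rewrite x0 raddf0. Qed.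

HB.instance Definition _ :=
  Lmodule_isNormed.Build R (subsp Y) ler_nrmD nrmZ nrm0_eq0.

End subsp_normed.

Lemma subsp_normE (R : realType) (X : normedModType R) (Y : submodClosed X)
  (y : subsp Y) : `|y| = `|val y|.
Proof. by []. Qed.

Definition separable (T : topologicalType) :=
  exists2 D : set T, countable D & dense D.

Definition dual (R : realType) (V : normedModType R) : set (V -> R) :=
  [set f : V -> R | scalar f /\ continuous f].

(* [sup] is total; on continuous linear f the set below is nonempty and bounded,
   so this is the operator norm. *)
Definition dual_norm (R : realType) (V : normedModType R) (f : V -> R) : R :=
  sup [set `|f x| | x in [set x : V | `|x| <= 1]].

Definition norm_preserving_extension (R : realType) (X : normedModType R)
    (Y : submodClosed X) (f : subsp Y -> R) (g : X -> R) :=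
  [/\ dual g, forall y : subsp Y, g (val y) = f y & dual_norm g = dual_norm f].

Definition property_wU (R : realType) (X : normedModType R)
    (Y : submodClosed X) :=
  forall f : subsp Y -> R, dual f ->
    (exists2 y0 : subsp Y, `|y0| = 1 & dual_norm f = `|f y0|) ->
    exists! g : X -> R, norm_preserving_extension f g.

(* Main.v *)
Require Import Defs.
From HB Require Import structures.
From mathcomp Require Import all_boot all_order all_algebra.
From mathcomp Require Import all_classical all_reals all_analysis.
Import Order.TTheory GRing.Theory Num.Theory.
Import numFieldNormedType.Exports.
Local Open Scope classical_set_scope.
Local Open Scope ring_scope.

Set Implicit Arguments.
Unset Strict Implicit.

(** Let [f] be a continuous functional on [Y] whose norm is attained at the unit
vector [y0], i.e. [dual_norm f = |f y0|].  For every subspace [Z] of [Y]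
containing [y0], the restriction of [f] to [Z] has the same norm, still attained
at [y0] ([dual_norm_restrict]).  So a norm-preserving extension of [f] is also
one of [f|Z], and if [y0 \in Z' `<=` Z] then a norm-preserving extension of
[f|Z] is also one of [f|Z'].

Apply this to [Z_y], the closed span of [y0] and [y], where [y] is in [Y].  It
lies in [Y] because [Y] is closed ([cspan_sub]) and is separable ([cspan_separable]), so [f|Z_y] has a
unique norm-preserving extension [h_y].  Write [g] for [h_y0], which comes from
the line through [y0].  Every [h_y] extends the restriction of [f] to that line
without increasing its norm, so [h_y = g] by uniqueness.  In particular
[g y = h_y y = f y] for every [y] in [Y]: the functional [g] determined by the
line extends all of [f].  This gives existence.  Uniqueness holds because
a norm-preserving extension of [f] is one of its restriction to the line. *)

Section closed_span_of_two_vectors.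
Context (R : realType) (X : normedModType R) (u v : X).

Definition comb (s t : R) : X := s *: u + t *: v.

(** The span equals its closure, being finite-dimensional; taking the closure
makes closedness immediate. *)
Definition cspan : {pred X} :=
  mem (closure [set x : X | exists s t, x = comb s t]).

Lemma cspan_closed : closed [set` cspan].
Proof.
have -> : [set` cspan] = closure [set x : X | exists s t, x = comb s t].
  by apply/seteqP; split=> x; rewrite /cspan /= inE.
exact: closed_closure.
Qed.

Lemma comb_cspan s t : comb s t \in cspan.
Proof. by rewrite inE; apply: subset_closure; exists s, t. Qed.

Lemma cspan_submod : submod_closed cspan.
Proof.
split; first by rewrite -[0](_ : comb 0 0 = 0) ?comb_cspan// /comb !scale0r addr0.
move=> a x y; rewrite !inE => Px Py.
move=> B /= nB.
have cB : (fun z : X * X => a *: z.1 + z.2) @ (x, y) --> a *: x + y.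
  by apply: cvgD; [apply: cvgZr; exact: cvg_fst|exact: cvg_snd].
have [[B1 B2] [/= nB1 nB2] B12] := cB _ nB.
have [_ [[s [t ->]] x1]] := Px _ nB1.
have [_ [[s' [t' ->]] x2]] := Py _ nB2.
exists (a *: comb s t + comb s' t'); split; last exact: (B12 (_, _)).
exists (a * s + s'), (a * t + t').
by rewrite /comb scalerDr !scalerA !scalerDl addrACA.
Qed.

HB.instance Definition _ := GRing.isSubmodClosed.Build R X cspan cspan_submod.

Lemma comb_continuousl t : continuous (comb^~ t).
Proof.
by move=> s; apply: cvgD; [apply: cvgZl; exact: cvg_id|exact: cvg_cst].
Qed.

Lemma comb_continuousr s : continuous (comb s).
Proof.
by move=> t; apply: cvgD; [exact: cvg_cst|apply: cvgZl; exact: cvg_id].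
Qed.

(** Density of the rationals is used in one coefficient at a time: the first is
moved to a rational with the second fixed, and then the second. *)
Lemma open_rat_comb (O : set X) s t : open O -> O (comb s t) ->
  exists p q : rat, O (comb (ratr p) (ratr q)).
Proof.
move=> oO Ost.
have op : open (comb^~ t @^-1` O).
  by apply: open_comp => // ? _; exact: comb_continuousl.
have [|r [Or [p _ pE]]] := dense_rat _ op; first by exists s.
have oq : open (comb (ratr p) @^-1` O).
  by apply: open_comp => // ? _; exact: comb_continuousr.
have [|r' [Or' [q _ qE]]] := dense_rat _ oq.
  by exists t; rewrite /preimage/= pE.
by exists p, q; rewrite qE.
Qed.

Lemma cspan_separable : separable (subsp cspan).
Proof.
pose d (pq : rat * rat) : subsp cspan :=
  exist _ (comb (ratr pq.1) (ratr pq.2)) (comb_cspan _ _).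
exists (range d); first exact: sub_countable (card_image_le _ _) (countableP _).
move=> O [z Oz] oO.
have /nbhs_ballP[e /= e0 zeO] : nbhs z O by exact: open_nbhs_nbhs.
have : val z \in cspan by exact: valP.
rewrite inE => /(_ (ball (val z) e)) [|_ [[s [t ->]] zst]].
  exact: nbhsx_ballx.
have [p [q zpq]] := open_rat_comb (ball_open _ _) zst.
exists (d (p, q)); split; last by exists (p, q).
by apply: zeO; move: zpq; rewrite -!ball_normE.
Qed.

Lemma comb10 : comb 1 0 = u.
Proof. by rewrite /comb scale1r scale0r addr0. Qed.

Lemma comb01 : comb 0 1 = v.
Proof. by rewrite /comb scale1r scale0r add0r. Qed.

Lemma cspan_sub (W : submodClosed X) : closed [set` W] ->
  u \in W -> v \in W -> {subset cspan <= W}.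
Proof.
move=> cW uW vW x; rewrite inE => Px; apply: cW.
apply: (closureS _ Px) => _ [s [t ->]].
by rewrite /= rpredD// rpredZ.
Qed.
End closed_span_of_two_vectors.

(** Guarantees that the [sup] defining [dual_norm f] is a genuine supremum. *)
Lemma dual_has_ubound (R : realType) (V : normedModType R) (f : V -> R) :
  dual f -> has_ubound [set `|f x| | x in [set x : V | `|x| <= 1]].
Proof.
move=> [lf cf].
pose F : {linear V -> R^o} := HB.pack f (GRing.isLinear.Build _ _ _ _ f lf).
have /linear_boundedP/pinfty_ex_gt0[r r0 fr] :=
  continuous_linear_bounded 0 (f := F) (cf 0).
exists r => _ [x /= x1 <-]; apply: le_trans (fr x) _.
by rewrite ger_pMr.
Qed.

Section restriction.
Context (R : realType) (X : normedModType R) (Z Y : submodClosed X)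
  (ZY : {subset Z <= Y}).

Definition incl (z : subsp Z) : subsp Y := exist _ (val z) (ZY (valP z)).

Lemma dual_restrict (f : subsp Y -> R) : dual f -> dual (f \o incl).
Proof.
move=> [lf cf]; split.
  move=> a x y /=; rewrite -lf; congr f; exact: val_inj.
move=> z; apply: continuous_comp; last exact: cf.
move=> A /nbhs_ballP[e /= e0 eA]; apply/nbhs_ballP; exists e => // w zw.
by apply: eA; move: zw; rewrite -!ball_normE.
Qed.

(** Restricting cannot increase the norm, and it cannot decrease it either when
the smaller space contains a unit vector where the norm is attained. *)
Lemma dual_norm_restrict (f : subsp Y -> R) (z0 : subsp Z) : dual f ->
  `|z0| = 1 -> dual_norm f = `|f (incl z0)| ->
  dual_norm (f \o incl) = `|f (incl z0)|.
Proof.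
move=> df z01 fz0; apply/eqP; rewrite eq_le; apply/andP; split.
  apply: ge_sup; first by exists `|f (incl z0)|, z0; rewrite //= z01.
  move=> _ [z /= z1 <-]; rewrite -fz0; apply: ub_le_sup.
    exact: dual_has_ubound.
  by exists (incl z).
apply: ub_le_sup; first exact/dual_has_ubound/dual_restrict.
by exists z0; rewrite //= z01.
Qed.
End restriction.

Unset Implicit Arguments.

Theorem corollary2p13 (R : realType) (X : completeNormedModType R)
    (Y : submodClosed X)
    (hY : closed [set` Y])
    (hsep : forall Z : submodClosed X,
        closed [set` Z] -> {subset Z <= Y} -> separable (subsp Z) ->
        property_wU Z) :
  property_wU Y.
Proof.
move=> f df [y0 y01 fy0].
have ZY (y : subsp Y) : {subset cspan (val y0) (val y) <= Y}.
  by apply: cspan_sub hY _ _; [exact: (valP y0)|exact: (valP y)].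
have y0Z (y : subsp Y) : val y0 \in cspan (val y0) (val y).
  by rewrite -[X in X \in _](comb10 (val y0) (val y)); exact: comb_cspan.
pose z0 (y : subsp Y) : subsp (cspan (val y0) (val y)) := exist _ (val y0) (y0Z y).
have z0E y : incl (@ZY y) (z0 y) = y0 by exact: val_inj.
have nZ y : dual_norm (f \o incl (@ZY y)) = `|f y0|.
  rewrite -[in RHS](z0E y); apply: (@dual_norm_restrict _ _ _ _ (@ZY y) f (z0 y)) => //.
  by rewrite z0E.
have uZ (y : subsp Y) : exists! g, norm_preserving_extension (f \o incl (@ZY y)) g.
  apply: hsep; [exact: cspan_closed|exact: ZY|exact: cspan_separable| |].
    exact: dual_restrict.
  by exists (z0 y) => //; rewrite nZ /= z0E.
(* The span of [y0] and [y0] is the line through [y0]. *)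
have [g [[dg gE ng] g_uniq]] := uZ y0.
exists g; split.
  split=> //; last by rewrite ng nZ.
  move=> y; have [h [[dh hE nh] _]] := uZ y.
  (* [h] extends [f] from the span of [y0] and [y], hence from the line. *)
  have -> : g = h.
    apply: g_uniq; split=> //; last by rewrite nh !nZ.
    move=> z; have zZ : val z \in cspan (val y0) (val y).
      exact: (cspan_sub (@cspan_closed _ _ _ _) (y0Z y) (y0Z y) (valP z)).
    rewrite -[val z]/(val (exist _ (val z) zZ : subsp (cspan _ _))) hE /=.
    by congr f; exact: val_inj.
  have yZ : val y \in cspan (val y0) (val y).
    by rewrite -[X in X \in _](comb01 (val y0) (val y)); exact: comb_cspan.
  rewrite -[val y]/(val (exist _ (val y) yZ : subsp (cspan _ _))) hE /=.
  by congr f; exact: val_inj.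
move=> h [dh hE nh]; apply: g_uniq; split=> //; last by rewrite nh nZ.
by move=> z; rewrite /= -hE.
Qed.
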